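(* Let $m=2n+1$ samples $(x_i,t_i,F_i)$, $i=1,\dots,m$, be given, with center $x_k$ and center timestamp $t_k$, and suppose $\operatorname{rank}(X_{\mathrm{aug}})=n+2$. Suppose the observation channel has the form $F(x,t)=f(x)+\mu(t)+\varepsilon(x,t)$, so that $F_i=f(x_i)+\mu(t_i)+\varepsilon(x_i,t_i)$, where $\mu\in C^2(\mathbb{R})$ and $|\mu''(t)|\le L_\mu$ for all $t$. Let $\tau_{\max}:=\max_i|t_i-t_k|$. Let $[c,g^\top,\gamma]^\top:=\Pi F$ with $F=(F_1,\dots,F_m)^\top$, and let $[c^{\mathrm{stat}},(g^{\mathrm{stat}})^\top,\gamma^{\mathrm{stat}}]^\top:=\Pi F^{\mathrm{stat}}$ with $F^{\mathrm{stat}}:=F-(\mu(t_1),\dots,\mu(t_m))^\top$. Then $$\bigl|\gamma-\gamma^{\mathrm{stat}}-\mu'(t_k)\bigr|\le C_\gamma L_\mu\tau_{\max},\qquad \bigl\|g-g^{\mathrm{stat}}\bigr\|_2\le C_g L_\mu\tau_{\max}^2,$$ where, for a fixed normalized sample geometry, the constants $C_\gamma,C_g>0$ are independent of $\tau_{\max}$ and $L_\mu$; they depend only on the spatial configuration $(d_1,\dots,d_m)$, the normalized temporal configuration $\hat\theta=\theta/\tau_{\max}$, and $\rho$.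
   Context: Here $f:\mathbb{R}^n\to\mathbb{R}$ is the latent objective and $\varepsilon(x,t)$ is observation noise. Put $d_i=x_i-x_k\in\mathbb{R}^n$, $\theta_i=t_i-t_k$, $\theta=(\theta_1,\dots,\theta_m)^\top$; $D\in\mathbb{R}^{m\times n}$ has rows $d_i^\top$; $\mathbf 1_m$ is the all-ones vector; $X_{\mathrm{aug}}=[\mathbf 1_m\;\;D\;\;\theta]\in\mathbb{R}^{m\times(n+2)}$. For a fixed $\rho>0$, $K=A+\tfrac1\rho I_m$ with $A_{ij}=\tfrac12(d_i^\top d_j)^2$ (symmetric positive definite), $S=X_{\mathrm{aug}}^\top K^{-1}X_{\mathrm{aug}}$ (invertible under the rank condition), and the recovery operator is $\Pi=S^{-1}X_{\mathrm{aug}}^\top K^{-1}\in\mathbb{R}^{(n+2)\times m}$. Vectors in $\mathbb{R}^{n+2}$ are split as $(c,g,\gamma)\in\mathbb{R}\times\mathbb{R}^n\times\mathbb{R}$. The rank condition forces $\theta\neq 0$, so $\tau_{\max}>0$. *)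

(* Defs.v *)
From HB Require Import structures.
From mathcomp Require Import all_boot all_order all_algebra.
From mathcomp Require Import all_classical all_reals all_analysis.

Set Implicit Arguments.
Unset Strict Implicit.
Unset Printing Implicit Defensive.

Import Order.TTheory GRing.Theory Num.Theory.
Import numFieldNormedType.Exports.

Local Open Scope classical_set_scope.
Local Open Scope ring_scope.

(* The library norm on matrices is the sup norm, hence this definition. *)
Definition norm2 (R : realType) (n : nat) (v : 'cV[R]_n) : R :=
  Num.sqrt (\sum_(i < n) v i 0 ^+ 2).

Definition C2 (R : realType) (mu : R -> R) : Prop :=
  [/\ forall s, derivable mu s 1,
      forall s, derivable mu^`()%classic s 1
    & continuous mu^`(2)%classic].

Section Recovery.
Variables (R : realType) (m n : nat).

(* Row i is d_i^T = (x_i - x_k)^T. *)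
Definition displacements (x : 'I_m -> 'cV[R]_n) (xk : 'cV[R]_n) : 'M[R]_(m, n) :=
  \matrix_(i < m, j < n) (x i - xk) j 0.

Definition time_offsets (t : 'I_m -> R) (tk : R) : 'cV[R]_m :=
  \col_(i < m) (t i - tk).

(* The default 0 is only reached for m = 0, all terms being nonnegative. *)
Definition max_abs (theta : 'cV[R]_m) : R :=
  \big[Num.max/0]_(i < m) `|theta i 0|.

Definition Xaug (D : 'M[R]_(m, n)) (theta : 'cV[R]_m) : 'M[R]_(m, 1 + n + 1) :=
  row_mx (row_mx (const_mx 1) D) theta.

Definition Kmx (D : 'M[R]_(m, n)) (rho : R) : 'M[R]_m :=
  \matrix_(i < m, j < m) (2^-1 * (\sum_(l < n) D i l * D j l) ^+ 2) + (rho^-1)%:M.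

Definition Smx (D : 'M[R]_(m, n)) (theta : 'cV[R]_m) (rho : R) :
    'M[R]_(1 + n + 1) :=
  (Xaug D theta)^T *m invmx (Kmx D rho) *m Xaug D theta.

Definition recovery (D : 'M[R]_(m, n)) (theta : 'cV[R]_m) (rho : R) :
    'M[R]_(1 + n + 1, m) :=
  invmx (Smx D theta rho) *m (Xaug D theta)^T *m invmx (Kmx D rho).

(* The blocks g and gamma of a vector (c, g, gamma). *)
Definition grad_part (v : 'cV[R]_(1 + n + 1)) : 'cV[R]_n := dsubmx (usubmx v).

Definition drift_part (v : 'cV[R]_(1 + n + 1)) : R := dsubmx v 0 0.

End Recovery.

(* Main.v *)
(* Writing mu(t_i) = mu(t_k) + mu'(t_k) theta_i + r_i, the mean value theorem
   applied twice gives |r_i| <= L_mu tau_max^2. Since Pi is a left inverse of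
   X_aug, it maps the affine part of this expansion to (mu(t_k), 0, mu'(t_k)),
   so the two errors are the blocks of Pi r. Finally X_aug is the matrix of the
   normalized configuration times T = diag(1, I, tau_max), whence T Pi is the
   recovery operator of the normalized configuration: it does not depend on
   tau_max, and T multiplies the drift component alone by tau_max. *)

Require Import Defs.
From HB Require Import structures.
From mathcomp Require Import all_boot all_order all_algebra.
From mathcomp Require Import all_classical all_reals all_analysis.
From mathcomp Require Import ring.

Set Implicit Arguments.
Unset Strict Implicit.
Unset Printing Implicit Defensive.

Import Order.TTheory GRing.Theory Num.Theory.
Import numFieldNormedType.Exports.

Local Open Scope classical_set_scope.
Local Open Scope ring_scope.

(** * Positive definiteness and invertibility of S *)

Definition posdef (R : realType) (p : nat) (M : 'M[R]_p) : Prop :=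
  forall u : 'rV[R]_p, u != 0 -> 0 < (u *m M *m u^T) 0 0.

Lemma posdef_unitmx (R : realType) (p : nat) (M : 'M[R]_p) :
  posdef M -> M \in unitmx.
Proof.
move=> Mpos; rewrite -row_free_unit; apply: inj_row_free => u uM0.
apply/eqP; apply: contraT => /Mpos.
by rewrite uM0 mul0mx mxE ltxx.
Qed.

(** With w = u M^-1, the positive scalar w M w^T is u (u M^-1)^T, the transpose of u M^-1 u^T. *)
Lemma posdef_invmx (R : realType) (p : nat) (M : 'M[R]_p) :
  posdef M -> posdef (invmx M).
Proof.
move=> Mpos u u0; have Mu := posdef_unitmx Mpos.
have w0 : u *m invmx M != 0.
  by apply: contraNneq u0 => w0; rewrite -(mulmxKV Mu u) w0 mul0mx.
have := Mpos _ w0; rewrite mulmxKV //.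
by rewrite -[u *m invmx M *m u^T]trmxK [(_ *m u^T)^T]trmx_mul trmxK [X in _ -> _ < X]mxE.
Qed.

(** Full column rank of X makes u -> u X^T injective, so a nonzero u gives a nonzero vector to test
    M on. *)
Lemma posdef_congr (R : realType) (m p : nat) (M : 'M[R]_m) (X : 'M[R]_(m, p)) :
  posdef M -> \rank X = p -> posdef (X^T *m M *m X).
Proof.
move=> Mpos rX u u0.
have w0 : u *m X^T != 0.
  by rewrite mulmx_free_eq0 // /row_free mxrank_tr rX.
by have := Mpos _ w0; rewrite trmx_mul trmxK !mulmxA.
Qed.

(** The regularization contributes |u|^2 / rho > 0, so it suffices that the quadratic kernel
    contributes a nonnegative amount. *)
Lemma Kmx_posdef (R : realType) (m n : nat) (D : 'M[R]_(m, n)) (rho : R) :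
  0 < rho -> posdef (Kmx D rho).
Proof.
move=> rho0 u u0.
have u2 : (u *m u^T) 0 0 = \sum_i u 0 i ^+ 2.
  by rewrite mxE; apply: eq_bigr => i _; rewrite mxE expr2.
have u2_gt0 : 0 < (u *m u^T) 0 0.
  rewrite u2 lt_neqAle sumr_ge0 ?andbT; last by move=> *; exact: sqr_ge0.
  rewrite eq_sym; apply: contra u0 => /eqP /psumr_eq0P u0.
  apply/eqP/rowP => i; rewrite mxE; apply/eqP.
  by rewrite -sqrf_eq0 u0 // => j _; exact: sqr_ge0.
rewrite /Kmx mulmxDr mulmxDl mxE mul_mx_scalar -scalemxAl ltr_wpDl //; last first.
  by rewrite mxE mulr_gt0 // invr_gt0.
(* The kernel [(d_i . d_j)^2] is the Gram matrix of the vectors of all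
   products of two coordinates of [d_i]. *)
suff -> : (u *m (\matrix_(i, j) (2^-1 * (\sum_l D i l * D j l) ^+ 2)) *m u^T) 0 0
    = 2^-1 * \sum_k \sum_l (\sum_i u 0 i * (D i k * D i l)) ^+ 2.
  apply: mulr_ge0; first by rewrite invr_ge0.
  by apply: sumr_ge0 => k _; apply: sumr_ge0 => l _; exact: sqr_ge0.
(* Both sides are expanded into one fourfold sum, using (d_i . d_j)^2 = sum over k, l of d_ik d_il
   d_jk d_jl; the rest is reordering. *)
transitivity (\sum_i \sum_j \sum_k \sum_l
    2^-1 * ((u 0 i * (D i k * D i l)) * (u 0 j * (D j k * D j l)))).
  rewrite mxE [RHS]exchange_big /=; apply: eq_bigr => j _.
  rewrite !mxE mulr_suml; apply: eq_bigr => i _.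
  rewrite !mxE expr2 big_distrlr /= !(mulr_sumr, mulr_suml); apply: eq_bigr => k _.
  by rewrite !(mulr_sumr, mulr_suml); apply: eq_bigr => l _; ring.
rewrite mulr_sumr.
under eq_bigr => i _ do rewrite exchange_big /=.
rewrite exchange_big /=; apply: eq_bigr => k _.
under eq_bigr => i _ do rewrite exchange_big /=.
rewrite exchange_big mulr_sumr /=; apply: eq_bigr => l _.
rewrite expr2 big_distrlr mulr_sumr; apply: eq_bigr => i _.
by rewrite mulr_sumr.
Qed.

Lemma Smx_unitmx (R : realType) (m n : nat) (D : 'M[R]_(m, n)) (theta : 'cV[R]_m)
    (rho : R) :
  0 < rho -> \rank (Xaug D theta) = (1 + n + 1)%N -> Smx D theta rho \in unitmx.
Proof.
move=> rho0 rX; apply: posdef_unitmx; apply: posdef_congr => //.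
by apply: posdef_invmx; apply: Kmx_posdef.
Qed.

(** These are the normal equations: they determine the recovery operator without inverting S, which
    suits arguments by cancellation. *)
Lemma Smx_recovery (R : realType) (m n : nat) (D : 'M[R]_(m, n))
    (theta : 'cV[R]_m) (rho : R) :
  Smx D theta rho \in unitmx ->
  Smx D theta rho *m recovery D theta rho =
  (Xaug D theta)^T *m invmx (Kmx D rho).
Proof. by move=> Su; rewrite /recovery -[X in _ *m X]mulmxA mulKVmx. Qed.

Lemma recovery_Xaug (R : realType) (m n : nat) (D : 'M[R]_(m, n))
    (theta : 'cV[R]_m) (rho : R) :
  Smx D theta rho \in unitmx -> recovery D theta rho *m Xaug D theta = 1%:M.
Proof. by move=> Su; rewrite /recovery -!mulmxA [X in _ *m X]mulmxA mulVmx. Qed.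

(** * Rescaling of time *)

Definition drift_scaling (R : realType) (n : nat) (tau : R) : 'M[R]_(1 + n + 1) :=
  block_mx 1%:M 0 0 tau%:M.

Lemma drift_scaling_tr (R : realType) (n : nat) (tau : R) :
  (drift_scaling n tau)^T = drift_scaling n tau.
Proof. by rewrite /drift_scaling tr_block_mx !trmx0 !tr_scalar_mx. Qed.

Lemma drift_scaling_unitmx (R : realType) (n : nat) (tau : R) :
  tau != 0 -> drift_scaling n tau \in unitmx.
Proof.
move=> tau0.
by rewrite unitmxE /drift_scaling det_ublock det1 mul1r det_scalar1 unitfE.
Qed.

Lemma Xaug_scale (R : realType) (m n : nat) (D : 'M[R]_(m, n)) (theta : 'cV[R]_m)
    (tau : R) :
  Xaug D (tau *: theta) = Xaug D theta *m drift_scaling n tau.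
Proof.
rewrite /Xaug /drift_scaling mul_row_block !mulmx0 addr0 add0r mulmx1.
by rewrite mul_mx_scalar.
Qed.

(** K depends on D alone, so S = T S' T, where S' belongs to the unscaled [theta]. Multiplied by T
    S', both sides become X^T K^-1, by the normal equations. *)
Lemma recovery_scale (R : realType) (m n : nat) (D : 'M[R]_(m, n))
    (theta : 'cV[R]_m) (tau rho : R) :
  tau != 0 -> Smx D (tau *: theta) rho \in unitmx ->
  drift_scaling n tau *m recovery D (tau *: theta) rho = recovery D theta rho.
Proof.
move=> tau0 Su; set T := drift_scaling n tau.
have Tu : T \in unitmx := drift_scaling_unitmx n tau0.
have SE : Smx D (tau *: theta) rho = T *m Smx D theta rho *m T.
  by rewrite /Smx Xaug_scale trmx_mul drift_scaling_tr !mulmxA.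
have Shu : Smx D theta rho \in unitmx.
  by move: Su; rewrite SE !unitmx_mul => /andP[/andP[]].
apply: (can_inj (mulKmx Shu)); apply: (can_inj (mulKmx Tu)).
rewrite [LHS]mulmxA [LHS]mulmxA -SE !Smx_recovery //.
by rewrite Xaug_scale trmx_mul drift_scaling_tr -mulmxA.
Qed.

Lemma drift_part_scale (R : realType) (n : nat) (tau : R) (w : 'cV[R]_(1 + n + 1)) :
  drift_part (drift_scaling n tau *m w) = tau * drift_part w.
Proof.
rewrite /drift_part /drift_scaling -{1}[w]vsubmxK mul_block_col col_mxKd.
by rewrite mul0mx add0r mul_scalar_mx mxE.
Qed.

Lemma grad_part_scale (R : realType) (n : nat) (tau : R) (w : 'cV[R]_(1 + n + 1)) :
  grad_part (drift_scaling n tau *m w) = grad_part w.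
Proof.
rewrite /grad_part /drift_scaling -{1}[w]vsubmxK mul_block_col col_mxKu.
by rewrite mul0mx addr0 mul1mx.
Qed.

(** * The Taylor remainder *)

(** Samples may precede or follow the center time, so a and b come in either order; c is located by
    its distance to a, as the second application requires. *)
Lemma mean_value (R : realType) (h : R -> R) (a b : R) :
  (forall s, derivable h s 1) ->
  exists2 c, `|c - a| <= `|b - a| & h b - h a = h^`()%classic c * (b - a).
Proof.
move=> dh.
have dh' (s : R) : is_derive s 1 h (h^`()%classic s).
  by rewrite derive1E; apply: DeriveDef.
have ch (i : interval R) : {within [set` i], continuous h}.
  by apply: derivable_within_continuous => s _.
have [ab|ba] := leP a b.
  have [c + ->] := MVT_segment ab (fun s _ => dh' s) (ch _).
  rewrite in_itv /= => /andP[ac cb]; exists c => //.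
  by rewrite !ger0_norm ?subr_ge0 // lerD2r.
have [c + hE] := MVT_segment (ltW ba) (fun s _ => dh' s) (ch _).
rewrite in_itv /= => /andP[bc ca]; exists c.
  by rewrite !ler0_norm ?subr_le0 ?(ltW ba) // lerN2 lerD2r.
by rewrite -opprB hE -mulrN opprB.
Qed.

(** The remainder is (mu'(c) - mu'(a)) (b - a) = mu''(e) (c - a) (b - a) with |c - a| <= |b - a|.
    This gives L instead of the sharp L/2. *)
Lemma taylor1_bound (R : realType) (mu : R -> R) (a b L : R) :
  C2 mu -> (forall s, `|mu^`(2)%classic s| <= L) ->
  `|mu b - mu a - mu^`()%classic a * (b - a)| <= L * `|b - a| ^+ 2.
Proof.
move=> [d1 d2 _] muL.
have [c ca ->] := mean_value a b d1.
have [e _ cE] := mean_value a c d2.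
rewrite -mulrBl cE !normrM expr2 mulrA ler_wpM2r // ler_pM //.
exact: muL.
Qed.

(** * Norm and rank estimates *)

Lemma le_max_abs (R : realType) (m : nat) (theta : 'cV[R]_m) (i : 'I_m) :
  `|theta i 0| <= max_abs theta.
Proof. exact: (le_bigmax _ (fun i => `|theta i 0|)). Qed.

Lemma norm_mulmx_entry (R : realType) (p m : nat) (P : 'M[R]_(p, m)) (r : 'cV[R]_m)
    (B : R) (i : 'I_p) :
  (forall j, `|r j 0| <= B) -> `|(P *m r) i 0| <= (\sum_j `|P i j|) * B.
Proof.
move=> rB; rewrite mxE mulr_suml; apply: le_trans (ler_norm_sum _ _ _) _.
by apply: ler_sum => j _; rewrite normrM ler_wpM2l.
Qed.

Lemma norm2_le_sum (R : realType) (n : nat) (v : 'cV[R]_n) :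
  norm2 v <= \sum_i `|v i 0|.
Proof.
have /andP[s0 s2] : (0 <= \sum_i `|v i 0|) &&
    (\sum_i v i 0 ^+ 2 <= (\sum_i `|v i 0|) ^+ 2).
  (* Nonnegativity of the partial sums is carried along to make the cross term of the square
     nonnegative. *)
  elim/big_rec2: _ => [|i y x _ /andP[x0 xy]]; first by rewrite expr0n !lexx.
  rewrite addr_ge0 //= sqrrD real_normK ?num_real // -addrA lerD2l.
  by rewrite (le_trans xy) // lerDr mulrn_wge0 // mulr_ge0.
by rewrite /norm2 -(ger0_norm s0) -sqrtr_sqr ler_sqrt // sqr_ge0.
Qed.

(** The zero time column lets the matrix factor through 1 + n columns; hence the rank condition
    excludes [theta] = 0. *)
Lemma rank_Xaug0 (R : realType) (m n : nat) (D : 'M[R]_(m, n)) :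
  (\rank (Xaug D 0) <= 1 + n)%N.
Proof.
have -> : Xaug D 0 = row_mx (const_mx 1) D *m row_mx 1%:M 0.
  by rewrite mul_mx_row mulmx1 mulmx0.
exact: leq_trans (mxrankM_maxl _ _) (rank_leq_col _).
Qed.

Lemma max_abs_gt0 (R : realType) (m : nat) (theta : 'cV[R]_m) :
  theta != 0 -> 0 < max_abs theta.
Proof.
apply: contraNT; rewrite -leNgt => tau0; apply/eqP/colP => i; rewrite mxE.
by apply/eqP; rewrite -normr_le0 (le_trans (le_max_abs theta i)).
Qed.

Lemma Xaug_affine (R : realType) (m n : nat) (D : 'M[R]_(m, n)) (theta : 'cV[R]_m)
    (a b : R) (i : 'I_m) :
  (Xaug D theta *m col_mx (col_mx a%:M 0) b%:M) i 0 = a + b * theta i 0.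
Proof.
by rewrite /Xaug !mul_row_col mulmx0 addr0 !mul_mx_scalar !mxE mulr1.
Qed.

Theorem theorem3p7 (R : realType) (n : nat) :
  exists Cgamma Cg : 'M[R]_((2 * n + 1)%N, n) -> 'cV[R]_(2 * n + 1) -> R -> R,
    (forall D thetahat rho, 0 < Cgamma D thetahat rho /\ 0 < Cg D thetahat rho) /\
    forall (rho : R) (x : 'I_(2 * n + 1) -> 'cV[R]_n) (t : 'I_(2 * n + 1) -> R)
      (F : 'cV[R]_(2 * n + 1)) (xk : 'cV[R]_n) (tk : R)
      (f : 'cV[R]_n -> R) (mu : R -> R) (eps : 'cV[R]_n -> R -> R) (Lmu : R),
    let D := displacements x xk in
    let theta := time_offsets t tk in
    let taumax := max_abs theta in
    let thetahat := taumax^-1 *: theta in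
    let Fstat := F - \col_(i < 2 * n + 1) mu (t i) in
    let v := recovery D theta rho *m F in
    let vstat := recovery D theta rho *m Fstat in
    0 < rho ->
    \rank (Xaug D theta) = (n + 2)%N ->
    (forall i, F i 0 = f (x i) + mu (t i) + eps (x i) (t i)) ->
    C2 mu ->
    (forall s, `|mu^`(2)%classic s| <= Lmu) ->
    `|drift_part v - drift_part vstat - mu^`()%classic tk|
      <= Cgamma D thetahat rho * Lmu * taumax /\
    norm2 (grad_part v - grad_part vstat)
      <= Cg D thetahat rho * Lmu * taumax ^+ 2.
Proof.
(* The sum of all absolute entries bounds every row sum and every sum of rows, so one constant
   serves both estimates; the added 1 makes it positive for all arguments. *)
pose C (D : 'M[R]_((2 * n + 1)%N, n)) (th : 'cV[R]_(2 * n + 1)) (rho : R) : R :=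
  1 + \sum_i \sum_j `|recovery D th rho i j|.
exists C, C; split.
  by move=> D th rho; rewrite /C ltr_pwDl // sumr_ge0 // => i _; rewrite sumr_ge0.
move=> rho x t F xk tk f mu eps Lmu D theta tau thetahat Fstat v vstat.
move=> rho0 rX _ muC2 muL.
have {}rX : \rank (Xaug D theta) = (1 + n + 1)%N by rewrite rX add1n addn2 addn1.
have theta0 : theta != 0.
  apply/eqP => theta0; have := rank_Xaug0 D.
  by rewrite -theta0 rX addn1 ltnn.
have tau0 : 0 < tau by apply: max_abs_gt0.
have thetaE : theta = tau *: thetahat by rewrite scalerA divff ?scale1r ?gt_eqF.
have Su := Smx_unitmx rho0 rX.
(* [e] holds the coefficients of the tangent line of [mu] at [tk], so [r] is the vector of Taylor
   remainders. *)
pose e : 'cV[R]_(1 + n + 1) := col_mx (col_mx (mu tk)%:M 0) (mu^`()%classic tk)%:M.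
pose r := \col_i mu (t i) - Xaug D theta *m e.
(* Objective and noise cancel in F - Fstat, which leaves the drift values X e + r. *)
have vE : v - vstat = e + recovery D theta rho *m r.
  rewrite /v /vstat -mulmxBr /Fstat opprB addrCA subrr addr0 /r mulmxBr.
  by rewrite mulmxA recovery_Xaug // mul1mx addrC subrK.
have L0 : 0 <= Lmu := le_trans (normr_ge0 _) (muL 0).
have rB j : `|r j 0| <= Lmu * tau ^+ 2.
  rewrite mxE [X in _ + X]mxE Xaug_affine [X in X - _]mxE [theta j 0]mxE opprD addrA.
  apply: le_trans (taylor1_bound tk (t j) muC2 muL) _.
  apply: ler_wpM2l => //.
  rewrite lerXn2r ?nnegrE ?normr_ge0 ?(ltW tau0) //.
  by have := le_max_abs theta j; rewrite mxE.
pose w := recovery D theta rho *m r.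
have wE : drift_scaling n tau *m w = recovery D thetahat rho *m r.
  by rewrite mulmxA thetaE recovery_scale -?thetaE ?gt_eqF.
have rowC (s : 'I_(1 + n + 1)) :
    \sum_j `|recovery D thetahat rho s j| <= C D thetahat rho.
  rewrite /C (bigD1 s) //= addrCA lerDl addr_ge0 // sumr_ge0 // => i _.
  exact: sumr_ge0.
have LT : 0 <= Lmu * tau ^+ 2 by rewrite mulr_ge0 // exprn_ge0 // ltW.
split.
  have -> : drift_part v - drift_part vstat - mu^`()%classic tk = drift_part w.
    have -> : drift_part v - drift_part vstat = drift_part (v - vstat).
      by rewrite /drift_part !mxE.
    rewrite vE -/w /drift_part linearD /e /= col_mxKd mxE [X in X + _ - _]mxE mulr1n.
    by rewrite addrAC subrr add0r.
  (* After multiplication by [tau] the left side is a component of the normalized operator applied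
     to [r], of order [tau ^+ 2]; dividing back leaves one power of [tau]. *)
  rewrite -(ler_pM2l tau0) -{1}[tau](gtr0_norm tau0) -normrM -drift_part_scale wE.
  have -> : tau * (C D thetahat rho * Lmu * tau) = C D thetahat rho * (Lmu * tau ^+ 2).
    by ring.
  rewrite /drift_part mxE; apply: le_trans (norm_mulmx_entry _ _ rB) _.
  exact: ler_wpM2r.
(* The scaling fixes the gradient block, so here the full factor [tau ^+ 2] remains. *)
have -> : grad_part v - grad_part vstat = grad_part (recovery D thetahat rho *m r).
  rewrite -wE grad_part_scale.
  have -> : w = v - vstat - e by rewrite vE addrAC subrr add0r.
  by rewrite /grad_part !linearB /= /e col_mxKu col_mxKd subr0.
apply: le_trans (norm2_le_sum _) _; rewrite -mulrA.
apply: (@le_trans _ _ (\sum_(i < n)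
    (\sum_j `|recovery D thetahat rho (lshift 1 (rshift 1 i)) j|) * (Lmu * tau ^+ 2))).
  apply: ler_sum => i _.
  by rewrite /grad_part [dsubmx _ _ _]mxE [usubmx _ _ _]mxE norm_mulmx_entry.
rewrite -mulr_suml ler_wpM2r // /C.
(* The rows split into those of c, g and gamma; only the g rows occur on the left, and the other
   terms are nonnegative. *)
rewrite !big_split_ord /= [X in 1 + X]addrAC addrA lerDr.
by rewrite !addr_ge0 // sumr_ge0 // => i _; exact: sumr_ge0.
Qed.
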